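(* Let $K$ be a finite field of positive characteristic $p$. Let $G \simeq H \times X$ be a finite abelian group, where $H$ is a $p$-regular group and $X$ is a $p$-group with the presentation $$X = \langle x_1, \dots, x_n \mid x_k^{p^{m_k}} = 1,\ [x_k,x_l]=1 \text{ for all } k, l \in \{1, 2, \dots, n\} \rangle,$$ where $n, m_k \in \{1,2,3,\dots\}$. For $i,j \in \{1, \dots, n\}$, let $f_i \colon \{x_1, \ldots, x_n\} \to KG$ be defined by $$f_i(x_j) = \begin{cases} 1 & \text{if } i = j,\\ 0 & \text{otherwise.}\end{cases}$$ Then $f_i$ can be uniquely extended to a derivation of $KG$, denoted by $\partial_i$. Moreover, $Der(KG)$ is a vector space over $K$ with basis $\{g\partial_i \mid g\in G,\ i=1,\ldots,n\}$.
   Context: $KG$ is the group algebra of $G$ over $K$; $G$ is identified with $H\times X$, so $H, X\subseteq G\subseteq KG$. A group is $p$-regular if none of its elements has order divisible by $p$. In the presentation, $[x_k,x_l]$ denotes the group commutator. A derivation of a ring $A$ is a map $d\colon A\to A$ with $d(a+b)=d(a)+d(b)$ and $d(ab)=d(a)b+a\,d(b)$ for all $a,b\in A$; $Der(A)$ is the set of all derivations of $A$. For $r\in KG$ and $d\in Der(KG)$, $rd$ denotes the map $a\mapsto r\,d(a)$; the $K$-vector space structure on $Der(KG)$ is given by pointwise addition and this action of $K$. *)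

(* Defs.v *)
From HB Require Import structures.
From mathcomp Require Import all_boot all_order all_fingroup all_algebra.
From mathcomp Require Import all_solvable all_field.

Set Implicit Arguments.
Unset Strict Implicit.
Unset Printing Implicit Defensive.

Import GRing.Theory.

Local Open Scope ring_scope.

(* The group algebra: functions G -> K under convolution. It is a separate     *)
(* constant because {ffun G -> K} carries the pointwise product in MathComp.   *)
Definition group_algebra (K : fieldType) (G : finGroupType) : Type :=
  {ffun G -> K^o}.

Section GroupAlgebra.

Variables (K : fieldType) (G : finGroupType).
Local Notation KG := (group_algebra K G).

HB.instance Definition _ := Vector.copy KG {ffun G -> K^o}.

Definition galg_coef (a : KG) (g : G) : K := (a : {ffun G -> K^o}) g.

Definition galg_of (g : G) : KG := [ffun h => (h == g)%:R : K^o].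

Definition galg_mul (a b : KG) : KG :=
  [ffun g => \sum_(h : G) galg_coef a h * galg_coef b (h^-1 * g)%g : K^o].

Lemma galg_mulE a b g : galg_coef (galg_mul a b) g =
  \sum_(h : G) galg_coef a h * galg_coef b (h^-1 * g)%g.
Proof. by rewrite /galg_coef ffunE. Qed.

Lemma galg_ofE g h : galg_coef (galg_of g) h = (h == g)%:R.
Proof. by rewrite /galg_coef ffunE. Qed.

Lemma galg_coefD a b g : galg_coef (a + b) g = galg_coef a g + galg_coef b g.
Proof. by rewrite /galg_coef ffunE. Qed.

Lemma galg_coefZ c a g : galg_coef (c *: a) g = c * galg_coef a g.
Proof. by rewrite /galg_coef ffunE. Qed.

Lemma galgP (a b : KG) : galg_coef a =1 galg_coef b -> a = b.
Proof. by move=> eq_ab; apply/ffunP. Qed.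

Fact galg_mulA : associative galg_mul.
Proof.
move=> a b c; apply: galgP => g; rewrite !galg_mulE.
under eq_bigr do rewrite galg_mulE big_distrr /=.
under [RHS]eq_bigr do rewrite galg_mulE big_distrl /=.
rewrite [RHS]exchange_big; apply: eq_bigr => h _ /=.
rewrite [RHS](reindex_inj (mulgI h)); apply: eq_bigr => k _ /=.
by rewrite mulKg invMg mulgA mulrA.
Qed.

Fact galg_mul1l : left_id (galg_of 1%g) galg_mul.
Proof.
move=> a; apply: galgP => g; rewrite galg_mulE (bigD1 1%g) //= galg_ofE eqxx.
rewrite mul1r invg1 mul1g big1 ?addr0 // => h /negbTE h1.
by rewrite galg_ofE h1 mul0r.
Qed.

Fact galg_mul1r : right_id (galg_of 1%g) galg_mul.
Proof.
move=> a; apply: galgP => g; rewrite galg_mulE (bigD1 g) //= galg_ofE mulVg.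
rewrite eqxx mulr1 big1 ?addr0 // => h hg; rewrite galg_ofE.
by rewrite -eq_mulVg1 (negbTE hg) mulr0.
Qed.

Fact galg_mulDl : left_distributive galg_mul +%R.
Proof.
move=> a b c; apply: galgP => g; rewrite galg_coefD !galg_mulE -big_split /=.
by apply: eq_bigr => h _; rewrite galg_coefD mulrDl.
Qed.

Fact galg_mulDr : right_distributive galg_mul +%R.
Proof.
move=> a b c; apply: galgP => g; rewrite galg_coefD !galg_mulE -big_split /=.
by apply: eq_bigr => h _; rewrite galg_coefD mulrDr.
Qed.

Fact galg_oner_neq0 : galg_of 1%g != 0 :> KG.
Proof.
apply/eqP => /(congr1 (galg_coef^~ 1%g)); rewrite galg_ofE eqxx.
by rewrite /galg_coef ffunE => /eqP; rewrite oner_eq0.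
Qed.

HB.instance Definition _ := GRing.Zmodule_isNzRing.Build KG
  galg_mulA galg_mul1l galg_mul1r galg_mulDl galg_mulDr galg_oner_neq0.

Fact galg_scaleAl (c : K) (a b : KG) : c *: (a * b) = (c *: a) * b.
Proof.
apply: galgP => g; rewrite galg_coefZ !galg_mulE big_distrr /=.
by apply: eq_bigr => h _; rewrite galg_coefZ mulrA.
Qed.

Fact galg_scaleAr (c : K) (a b : KG) : c *: (a * b) = a * (c *: b).
Proof.
apply: galgP => g; rewrite galg_coefZ !galg_mulE big_distrr /=.
by apply: eq_bigr => h _; rewrite galg_coefZ mulrCA.
Qed.

HB.instance Definition _ := GRing.Lmodule_isLalgebra.Build K KG galg_scaleAl.
HB.instance Definition _ := GRing.Lalgebra_isAlgebra.Build K KG galg_scaleAr.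
HB.instance Definition _ := Algebra_isFalgebra.Build K KG.

Lemma galg_of1 : galg_of 1%g = 1.
Proof. by []. Qed.

Lemma galg_ofM g h : galg_of (g * h)%g = galg_of g * galg_of h.
Proof.
apply: galgP => k; rewrite galg_mulE (bigD1 g) //= !galg_ofE eqxx mul1r.
rewrite big1 ?addr0 => [|l /negbTE lg]; last by rewrite galg_ofE lg mul0r.
by rewrite -(inj_eq (mulgI g^-1)%g) mulKg.
Qed.

End GroupAlgebra.

HB.instance Definition _ (K : finFieldType) (G : finGroupType) :=
  isCountable.Build (group_algebra K G) (@pickleK {ffun G -> K}).
HB.instance Definition _ (K : finFieldType) (G : finGroupType) :=
  isFinite.Build (group_algebra K G) (@enumP {ffun G -> K}).

Definition derivation (A : pzRingType) (d : A -> A) : Prop :=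
  (forall a b, d (a + b) = d a + d b) /\
  (forall a b, d (a * b) = d a * b + a * d b).

(* Since KG is finite, {ffun KG -> KG} is the set of all maps KG -> KG; its    *)
(* library K-vector space structure is the pointwise one.                      *)
Definition galg_maps (K : finFieldType) (G : finGroupType) : vectType K :=
  {ffun group_algebra K G -> group_algebra K G}.

Definition lscale_map (K : finFieldType) (G : finGroupType)
  (r : group_algebra K G) (d : galg_maps K G) : galg_maps K G :=
  [ffun a => r * d a].

Definition p_regular (p : nat) (gT : finGroupType) (H : {set gT}) : Prop :=
  forall h, h \in H -> ~~ (p %| #[h]%g)%N.

(* X = < x_k | rel >: the x_k generate X, satisfy rel, and X is universal for  *)
(* this among all groups, finite or not.                                       *)
Definition presented_by (gT : finGroupType) (X : {set gT}) (n : nat)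
    (x : 'I_n -> gT) (rel : forall rT : groupType, ('I_n -> rT) -> Prop) :
    Prop :=
  [/\ X = <<[set x k | k : 'I_n]>>%g, rel gT x &
      forall (rT : groupType) (y : 'I_n -> rT), rel rT y ->
        exists2 f : gT -> rT,
          {in X &, {morph f : a b / (a * b)%g}} & forall k, f (x k) = y k].

Definition abelian_ppower_rel (p n : nat) (m : 'I_n -> nat) (rT : groupType)
    (y : 'I_n -> rT) : Prop :=
  (forall k, (y k ^+ (p ^ m k)%N)%g = 1%g) /\
  (forall k l, [~ y k, y l]%g = 1%g).

(* Main.v *)
Require Import Defs.
From mathcomp Require Import all_boot all_order all_fingroup all_algebra.
From mathcomp Require Import all_solvable all_field.

Set Implicit Arguments.
Unset Strict Implicit.
Unset Printing Implicit Defensive.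

Import GRing.Theory FinRing.Theory.

Local Open Scope ring_scope.

(** Existence. The universal property of X, applied to the additive group of K
    (where p annihilates everything and m_k > 0), yields for each i an additive
    character chi_i : X -> (K, +) with chi_i(x_j) = delta_ij, which is extended
    to G through the projection of H * X onto X ([dual_weights]). Multiplying
    the coefficient at g by chi_i(g), for all g, is a derivation of KG because
    chi_i is additive on products ([galg_weight_derivation]); it is the
    analogue of the Euler operator t d/dt. Multiplying it by x_i^-1 gives the
    partial derivative, which sends x_j to x_i^-1 delta_ij x_j = delta_ij.

    Rigidity. A derivation of a commutative ring satisfies
    d(a^n) = n a^(n-1) d(a). It therefore kills the scalars, since c = c^#|K| and
    #|K| = 0 in K, and is K-linear. It also kills every h in H, since h^r = 1
    with r invertible in K. As H and the x_j generate G, and G spans KG, a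
    derivation is determined by the elements d(x_j) ([derivation_rigid]).

    Basis. A combination D of the maps g partial_i with coefficients c(g, i)
    satisfies D(x_j) = sum_g c(g, j) g ([lincomb_gpartials_dual]). So D = 0
    forces c = 0, and by rigidity an arbitrary derivation d is the combination
    whose c(g, j) are the coefficients of d(x_j). *)

(** * Derivations of rings and algebras *)

Section Derivation.

Variables (A : pzRingType) (d : A -> A).
Hypothesis derd : derivation d.

Lemma derivation1 : d 1 = 0.
Proof.
have [_ dM] := derd; apply: (addrI (d 1)).
by rewrite addr0 -{3}[1]mulr1 dM mulr1 mul1r.
Qed.

Lemma derivation0 : d 0 = 0.
Proof. by have [dD _] := derd; apply: (addrI (d 0)); rewrite -dD !addr0. Qed.

Lemma derivation_sum (I : Type) (s : seq I) (F : I -> A) :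
  d (\sum_(i <- s) F i) = \sum_(i <- s) d (F i).
Proof. by have [dD _] := derd; apply: (big_morph d dD derivation0). Qed.

Lemma derivationX a n :
  GRing.comm a (d a) -> d (a ^+ n) = a ^+ n.-1 * d a *+ n.
Proof.
have [_ dM] := derd => cad; elim: n => [|n IHn].
  by rewrite expr0 derivation1 mulr0n.
rewrite exprS dM IHn mulrS /= (commrX n (commr_sym cad)); congr (_ + _).
by case: n {IHn} => [|n]; rewrite ?mulr0n ?mulr0 // mulrnAr mulrA -exprS.
Qed.

Lemma derivation_lmul r :
  (forall a, GRing.comm r a) -> derivation (fun a => r * d a).
Proof.
have [dD dM] := derd => rC; split=> a b; first by rewrite dD mulrDr.
by rewrite dM mulrDr !mulrA -(rC a).
Qed.

End Derivation.

(** From 0 = d(u^r) = r u^(r-1) d(u), first r and then the unit u^(r-1), whose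
    inverse is u, can be cancelled. *)
Lemma derivation_unity_root (K : fieldType) (A : algType K) (d : A -> A)
    (u : A) r :
  derivation d -> GRing.comm u (d u) -> r%:R != 0 :> K -> u ^+ r = 1 -> d u = 0.
Proof.
move=> derd cud r0 ur1; have := derivationX derd r cud.
rewrite ur1 derivation1 // -scaler_nat => /esym/eqP.
rewrite scaler_eq0 (negbTE r0) /= => /eqP ud0.
case: r => [|r] in r0 ur1 ud0; first by rewrite eqxx in r0.
by rewrite -[d u]mul1r -ur1 exprS -mulrA ud0 mulr0.
Qed.

(** Every scalar is a power c = c^#|K| whose exponent vanishes in K. *)
Lemma derivation_scalar (K : finFieldType) (A : algType K) (d : A -> A) c :
  derivation d -> d c%:A = 0.
Proof.
move=> derd; have cC: GRing.comm c%:A (d c%:A).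
  by rewrite /GRing.comm mulr_algl mulr_algr.
have q0: #|K|%:R = 0 :> K by rewrite -zmodXgE -cardsT expg_cardG ?inE.
rewrite -{1}(expf_card c) -in_algE rmorphXn /= derivationX //.
by rewrite -scaler_nat q0 scale0r.
Qed.

Lemma derivation_scale (K : finFieldType) (A : algType K) (d : A -> A) c a :
  derivation d -> d (c *: a) = c *: d a.
Proof.
move=> derd; have [_ dM] := derd.
by rewrite -mulr_algl dM derivation_scalar // mul0r add0r mulr_algl.
Qed.

(** * The group algebra and its diagonal derivations *)

Section GroupAlgebra.

Variables (K : fieldType) (G : finGroupType).
Local Notation KG := (group_algebra K G).

Lemma galg_coef_sum (I : Type) (s : seq I) (F : I -> KG) g :
  galg_coef (\sum_(i <- s) F i) g = \sum_(i <- s) galg_coef (F i) g.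
Proof.
apply: (big_morph (fun a : KG => galg_coef a g)) => [a b|].
  exact: galg_coefD.
by rewrite /galg_coef ffunE.
Qed.

Lemma galg_coef_lincomb (c : G -> K) h :
  galg_coef (\sum_(g <- enum G) c g *: galg_of K g) h = c h.
Proof.
rewrite galg_coef_sum big_enum /= (bigD1 h) //= galg_coefZ galg_ofE eqxx mulr1.
by rewrite big1 ?addr0 // => g gh; rewrite galg_coefZ galg_ofE eq_sym
  (negbTE gh) mulr0.
Qed.

Lemma galg_decomp (a : KG) :
  a = \sum_(g <- enum G) galg_coef a g *: galg_of K g.
Proof. by apply: galgP => h; rewrite galg_coef_lincomb. Qed.

Lemma galg_ofX (g : G) r : galg_of K (g ^+ r)%g = galg_of K g ^+ r.
Proof.
elim: r => [|r IHr]; first by rewrite expg0 expr0 galg_of1.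
by rewrite expgS galg_ofM IHr exprS.
Qed.

Lemma galg_comm : abelian [set: G] -> forall a b : KG, GRing.comm a b.
Proof.
move=> abG a b; have cG (g h : G) : (g * h = h * g)%g.
  by apply: (centsP abG); rewrite inE.
apply: galgP => g; rewrite !galg_mulE (reindex_inj (mulgI g)%g) /=.
rewrite (reindex_inj invg_inj); apply: eq_bigr => h _ /=.
by rewrite mulrC (cG h^-1%g) invMg invgK -mulgA mulVg mulg1.
Qed.

Definition galg_weight (chi : G -> K) (a : KG) : KG :=
  [ffun g => chi g * galg_coef a g : K^o].

Lemma galg_weightE chi a g :
  galg_coef (galg_weight chi a) g = chi g * galg_coef a g.
Proof. by rewrite /galg_coef ffunE. Qed.

Lemma galg_weight_of chi g :
  galg_weight chi (galg_of K g) = chi g *: galg_of K g.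
Proof.
apply: galgP => h; rewrite galg_weightE galg_coefZ galg_ofE.
by have [->|] := eqVneq h g; rewrite ?mulr0.
Qed.

(** Leibniz rule: in the convolution, the term a(h) b(h^-1 g) has weight
    chi(g) = chi(h) + chi(h^-1 g). *)
Lemma galg_weight_derivation (chi : G -> K) :
  (forall g h, chi (g * h)%g = chi g + chi h) -> derivation (galg_weight chi).
Proof.
move=> chiM; split=> a b; apply: galgP => g.
  by rewrite galg_coefD !galg_weightE galg_coefD mulrDr.
rewrite galg_coefD galg_weightE !galg_mulE big_distrr -big_split /=.
apply: eq_bigr => h _; rewrite !galg_weightE.
by rewrite -{1}[g](mulKVg h) chiM mulrDl mulrA [in X in _ + X]mulrCA.
Qed.

(** By the Leibniz rule, the g at which two derivations agree form a submonoid
    of the finite group G, hence a subgroup. *)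
Lemma derivation_eq_gen (d1 d2 : KG -> KG) (S : {set G}) :
    derivation d1 -> derivation d2 ->
    {in S, forall g, d1 (galg_of K g) = d2 (galg_of K g)} ->
  {in <<S>>%g, forall g, d1 (galg_of K g) = d2 (galg_of K g)}.
Proof.
move=> der1 der2 eqS; pose T := [set g | d1 (galg_of K g) == d2 (galg_of K g)].
have gT: group_set T.
  apply/group_setP; split=> [|g h]; rewrite !inE.
    by rewrite galg_of1 !derivation1.
  have [[_ d1M] [_ d2M]] := (der1, der2).
  by move=> /eqP eq_g /eqP eq_h; rewrite galg_ofM d1M d2M eq_g eq_h.
have sST: (<<S>> \subset Group gT)%g.
  by rewrite gen_subG; apply/subsetP => g Sg; rewrite inE eqS.
by move=> g /(subsetP sST); rewrite inE => /eqP.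
Qed.

End GroupAlgebra.

(** * Existence of dual weights, and rigidity *)

(** The universal property is used with the additive group of K in the role of
    the target, the tuple y being delta_i; the relations hold there because
    p^(m k) is zero in K when m k > 0. *)
Lemma dual_weights (K : finFieldType) (p : nat) (G : finGroupType)
    (H X : {group G}) (n : nat) (m : 'I_n -> nat) (x : 'I_n -> G) :
    p \in [pchar K] -> (H \x X)%g = [set: G] -> (forall k, 0 < m k)%N ->
    presented_by X x (abelian_ppower_rel p m) ->
  exists chi : 'I_n -> G -> K, forall i,
    (forall g h, chi i (g * h)%g = chi i g + chi i h) /\
    (forall j, chi i (x j) = (i == j)%:R).
Proof.
move=> charK defG m_gt0 [defX _ univX].
apply: (@fin_all_exists _ (fun=> G -> K) (fun i chi =>
  (forall g h, chi (g * h)%g = chi g + chi h) /\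
  (forall j, chi (x j) = (i == j)%:R))) => i.
have relK: abelian_ppower_rel p m (rT := K) (fun j => (i == j)%:R : K).
  split=> [k|k l]; last first.
    by apply/eqP/commgP; rewrite /commute !zmodMgE addrC.
  rewrite zmodXgE -mulrnA natrM natrX (pcharf0 charK) expr0n.
  by rewrite eqn0Ngt m_gt0 mulr0.
have [phi phiM phix] := univX K _ relK.
have [_ HX_G _ tiHX] := dprodP defG.
have [nHG XcompG] :
    (H <| [set: G])%g /\ (X \in [complements to H in [set: G]])%g.
  by split; [case/dprod_normal2: defG | apply/complP].
exists (fun g => phi (remgr H X g)); split=> [g h|j].
  by rewrite (remgrM XcompG nHG) ?inE // phiM ?mem_remgr ?HX_G ?inE.
by rewrite remgr_id ?phix // defX mem_gen // imset_f.
Qed.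

(** Both derivations vanish on H, whose elements have order invertible in K, so
    they agree on a generating set of G, and K-linearity does the rest. *)
Lemma derivation_rigid (K : finFieldType) (p : nat) (G : finGroupType)
    (H X : {group G}) (n : nat) (x : 'I_n -> G)
    (d1 d2 : group_algebra K G -> group_algebra K G) :
    p \in [pchar K] -> abelian [set: G] -> (H \x X)%g = [set: G] ->
    p_regular p H -> (X :=: <<[set x k | k : 'I_n]>>)%g ->
    derivation d1 -> derivation d2 ->
    (forall j, d1 (galg_of K (x j)) = d2 (galg_of K (x j))) ->
  d1 =1 d2.
Proof.
move=> charK abG defG regH defX der1 der2 eqx a.
have der_H d h : derivation d -> h \in H -> d (galg_of K h) = 0.
  move=> derd Hh; apply: (derivation_unity_root (r := #[h]%g) derd).
  - exact: galg_comm.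
  - by rewrite -(dvdn_pcharf charK) regH.
  - by rewrite -galg_ofX expg_order.
have eqG g : d1 (galg_of K g) = d2 (galg_of K g).
  pose S := (H :|: [set x k | k : 'I_n])%g.
  apply: (@derivation_eq_gen _ _ d1 d2 S) => // [h|].
    by case/setUP=> [Hh | /imsetP[k _ ->] //]; rewrite !der_H.
  have [_ HX_G _ _] := dprodP defG.
  have: g \in (H * X)%g by rewrite HX_G inE.
  case/mulsgP=> h y Hh Xy ->; rewrite groupM //.
    by rewrite mem_gen // inE Hh.
  by rewrite defX in Xy; apply: (subsetP (genS _)) Xy; apply: subsetUr.
rewrite [a]galg_decomp !derivation_sum //.
by apply: eq_bigr => g _; rewrite !derivation_scale ?eqG.
Qed.

(** * The basis given by a dual family of derivations *)

Lemma free_map (K : fieldType) (V : vectType K) (I : eqType) (s : seq I)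
    (v : I -> V) :
    uniq s ->
    (forall c : I -> K,
       \sum_(i <- s) c i *: v i = 0 -> {in s, forall i, c i = 0}) ->
  free (map v s).
Proof.
case: s => [|z0 s']; first by rewrite nil_free.
move: (z0 :: s') (erefl _ : size (z0 :: s') = (size s').+1) => s szs us indep.
have szv: size (map v s) == (size s').+1 by rewrite size_map szs.
rewrite -[map v s]/(tval (Tuple szv)); apply/freeP => k k0 i.
have lt_i : (i < size s)%N by rewrite szs.
have := indep (fun z => k (inord (index z s))) _ (nth z0 s i) (mem_nth _ lt_i).
rewrite index_uniq // inord_val; apply.
rewrite -[RHS]k0 (big_nth z0) szs big_mkord; apply: eq_bigr => j _.
by rewrite index_uniq ?szs // inord_val /= (nth_map z0) ?szs.
Qed.

Section Maps.

Variables (K : finFieldType) (G : finGroupType).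
Local Notation KG := (group_algebra K G).

Lemma derivation_lincomb (I : Type) (s : seq I) (c : I -> K)
    (F : I -> galg_maps K G) :
    (forall i, @derivation KG (F i)) ->
  @derivation KG (\sum_(i <- s) c i *: F i : galg_maps K G).
Proof.
move=> derF; elim/big_rec: _ => [|i e _ [eD eM]].
  by split=> a b; rewrite !ffunE ?mul0r ?mulr0 addr0.
have [FD FM] := derF i; split=> a b; rewrite !ffunE ?eD ?eM ?FD ?FM.
  by rewrite scalerDr addrACA.
by rewrite mulrDl mulrDr scalerDr scalerAl scalerAr addrACA.
Qed.

Lemma lscale_map_lincomb (c : G -> K) (d : galg_maps K G) a :
  (\sum_(g <- enum G) c g *: lscale_map (galg_of K g) d : galg_maps K G) a =
  (\sum_(g <- enum G) c g *: galg_of K g) * d a.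
Proof.
rewrite sum_ffunE mulr_suml; apply: eq_bigr => g _.
by rewrite !ffunE -scalerAl.
Qed.

End Maps.

Section DualFamily.

Variables (K : finFieldType) (G : finGroupType) (n : nat) (x : 'I_n -> G).
Local Notation KG := (group_algebra K G).

Variable partial : 'I_n -> galg_maps K G.
Hypothesis der_partial : forall i, @derivation KG (partial i).
Hypothesis partialx : forall i j, partial i (galg_of K (x j)) = (i == j)%:R.
Hypothesis galgC : forall a b : KG, GRing.comm a b.
Hypothesis rigid : forall d1 d2 : KG -> KG, derivation d1 -> derivation d2 ->
  (forall j, d1 (galg_of K (x j)) = d2 (galg_of K (x j))) -> d1 =1 d2.

Local Notation gpartials :=
  [seq lscale_map (galg_of K g) (partial i) | g <- enum G, i <- enum 'I_n].

Lemma derivation_gpartial g i :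
  @derivation KG (lscale_map (galg_of K g) (partial i)).
Proof.
have [dD dM] := derivation_lmul (der_partial i) (galgC (galg_of K g)).
by split=> a b; rewrite !ffunE.
Qed.

(** Evaluation at x_j reads off the coefficients with second index j: this gives
    both the independence of the maps g partial_i and the coordinates of a
    derivation. *)
Lemma lincomb_gpartials_dual (c : G * 'I_n -> K) j :
  (\sum_(z <- [seq (g, i) | g <- enum G, i <- enum 'I_n])
     c z *: lscale_map (galg_of K z.1) (partial z.2) : galg_maps K G)
    (galg_of K (x j)) = \sum_(g <- enum G) c (g, j) *: galg_of K g.
Proof.
rewrite big_allpairs exchange_big /= sum_ffunE (bigD1_seq j) ?enum_uniq //=;
  last by rewrite mem_enum.
rewrite lscale_map_lincomb partialx eqxx mulr1 [X in _ + X]big1 ?addr0 // => i.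
by move=> /negbTE ij; rewrite lscale_map_lincomb partialx ij mulr0.
Qed.

Lemma gpartials_map :
  gpartials = [seq lscale_map (galg_of K z.1) (partial z.2)
              | z <- [seq (g, i) | g <- enum G, i <- enum 'I_n]].
Proof. by rewrite map_allpairs. Qed.

Lemma free_gpartials : free gpartials.
Proof.
rewrite gpartials_map; apply: free_map => [|c c0 [g j] _].
  by apply: allpairs_uniq; rewrite ?enum_uniq // => -[? ?] [? ?].
rewrite -(galg_coef_lincomb (fun g => c (g, j))) -lincomb_gpartials_dual c0.
by rewrite /galg_coef !ffunE.
Qed.

Lemma span_gpartials (d : galg_maps K G) :
  d \in <<gpartials>>%VS <-> @derivation KG d.
Proof.
split=> [/(@coord_span _ _ _ (in_tuple gpartials))-> | derd].
  apply: derivation_lincomb => i.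
  have: (in_tuple gpartials)`_i \in gpartials by rewrite mem_nth.
  by case/allpairsP=> z [_ _ ->]; apply: derivation_gpartial.
pose c (z : G * 'I_n) := galg_coef (d (galg_of K (x z.2))) z.1.
have ->: d = \sum_(z <- [seq (g, i) | g <- enum G, i <- enum 'I_n])
     c z *: lscale_map (galg_of K z.1) (partial z.2).
  apply/ffunP; apply: rigid => // [|j].
    by apply: derivation_lincomb => z; apply: derivation_gpartial.
  by rewrite lincomb_gpartials_dual [LHS]galg_decomp.
rewrite gpartials_map big_seq; apply: memv_suml => z sz.
by apply/memvZ/memv_span/mapP; exists z.
Qed.

Lemma basis_gpartials : basis_of <<gpartials>>%VS gpartials.
Proof. by rewrite /basis_of eqxx free_gpartials. Qed.

End DualFamily.

Theorem theorem3p4 (K : finFieldType) (p : nat) (charK : p \in [pchar K])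
    (G : finGroupType) (abG : abelian [set: G])
    (H X : {group G}) (defG : (H \x X)%g = [set: G])
    (regH : p_regular p H) (pX : (p.-group X)%g)
    (n : nat) (n_gt0 : (0 < n)%N)
    (m : 'I_n -> nat) (m_gt0 : forall k, (0 < m k)%N)
    (x : 'I_n -> G) (presX : presented_by X x (abelian_ppower_rel p m))
    (f : 'I_n -> 'I_n -> group_algebra K G)
    (defF : forall i j, f i j = if i == j then 1 else 0) :
  exists partial : 'I_n -> galg_maps K G,
    (forall i, unique
       (fun d : galg_maps K G =>
          @derivation (group_algebra K G) d /\ forall j, d (galg_of K (x j)) = f i j)
       (partial i)) /\
    exists2 DerKG : {vspace galg_maps K G},
      forall d : galg_maps K G, d \in DerKG <-> @derivation (group_algebra K G) d &
      basis_of DerKG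
        [seq lscale_map (galg_of K g) (partial i) | g <- enum G, i <- enum 'I_n].
Proof.
have galgC := @galg_comm K G abG.
have [defX _ _] := presX.
have rigid d1 d2 :=
  @derivation_rigid K p G H X n x d1 d2 charK abG defG regH defX.
have [chi chiP] := dual_weights charK defG m_gt0 presX.
(* The analogue of d/dt = t^-1 (t d/dt). *)
pose partial i : galg_maps K G :=
  [ffun a => galg_of K (x i)^-1%g * galg_weight (chi i) a].
have der_partial i : @derivation (group_algebra K G) (partial i).
  have [chiM _] := chiP i.
  have [dD dM] := derivation_lmul (galg_weight_derivation chiM)
                    (galgC (galg_of K (x i)^-1%g)).
  by split=> a b; rewrite !ffunE.
have partialx i j : partial i (galg_of K (x j)) = (i == j)%:R.
  have [_ chix] := chiP i; rewrite ffunE galg_weight_of chix.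
  have [<-|_] := eqVneq i j; last by rewrite scale0r mulr0.
  by rewrite scale1r -galg_ofM mulVg.
exists partial; split=> [i|].
  have fE j : (i == j)%:R = f i j by rewrite defF; case: eqP.
  split=> [|d [derd dx]]; first by split=> // j; rewrite partialx.
  by apply/ffunP; apply: rigid => // j; rewrite partialx dx.
exists <<[seq lscale_map (galg_of K g) (partial i)
         | g <- enum G, i <- enum 'I_n]>>%VS.
  exact: span_gpartials partialx galgC rigid.
exact: basis_gpartials partialx.
Qed.
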